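(* Let $(\mathcal C,\mathbb E,\mathfrak s)$ be an extriangulated category satisfying Condition (WIC), and let $\xi$ be a proper class of $\mathbb E$-triangles such that $\mathcal C$ has enough $\xi$-projectives and enough $\xi$-injectives. Then the class $\mathcal{QGP}(\xi)$ of quasi-$\xi$-Gorenstein projective objects is closed under direct summands.
   Context: Extriangulated categories (Nakaoka–Palu). $\mathcal C$ is an additive category with a biadditive functor $\mathbb E:\mathcal C^{op}\times\mathcal C\to\mathbf{Ab}$. An element $\delta\in\mathbb E(C,A)$ is an $\mathbb E$-extension; write $a_*\delta=\mathbb E(C,a)(\delta)$ and $c^*\delta=\mathbb E(c,A)(\delta)$. A morphism $(a,c):\delta\to\delta'$ from $\delta\in\mathbb E(C,A)$ to $\delta'\in\mathbb E(C',A')$ is a pair $a:A\to A'$, $c:C\to C'$ with $a_*\delta=c^*\delta'$. Sequences $A\to B\to C$ and $A\to B'\to C$ are equivalent if there is an isomorphism $B\to B'$ compatible with $1_A,1_C$. A realization $\mathfrak s$ assigns to each $\delta\in\mathbb E(C,A)$ an equivalence class $[A\xrightarrow{x}B\xrightarrow{y}C]$ such that every morphism $(a,c)$ of extensions extends to a commutative $(a,b,c)$ between the realizing sequences; it is additive if $\mathfrak s(0)=[A\to A\oplus C\to C]$ and $\mathfrak s(\delta\oplus\delta')=\mathfrak s(\delta)\oplus\mathfrak s(\delta')$. The triple is extriangulated if: (ET1) $\mathbb E$ is biadditive; (ET2) $\mathfrak s$ is an additive realization; (ET3) if $A\xrightarrow{x}B\xrightarrow{y}C$, $A'\xrightarrow{x'}B'\xrightarrow{y'}C'$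 realize $\delta,\delta'$ and $bx=x'a$, then there is $c$ with $cy=y'b$ and $a_*\delta=c^*\delta'$; (ET3)$^{op}$ the dual; (ET4) if $A\xrightarrow{f}B\xrightarrow{f'}D$ realizes $\delta$ and $B\xrightarrow{g}C\xrightarrow{g'}F$ realizes $\delta'$, there are an object $E$, morphisms $h=gf$, $h':C\to E$, $d:D\to E$, $e:E\to F$ with $h'g=df'$, $eh'=g'$, and $\delta''\in\mathbb E(E,A)$ realized by $A\xrightarrow{h}C\xrightarrow{h'}E$, such that $D\xrightarrow{d}E\xrightarrow{e}F$ realizes $f'_*\delta'$, $d^*\delta''=\delta$, $f_*\delta''=e^*\delta'$; (ET4)$^{op}$ the dual. If $A\xrightarrow{x}B\xrightarrow{y}C$ realizes $\delta$, then $x$ is called an inflation, $y$ a deflation, and $A\xrightarrow{x}B\xrightarrow{y}C\overset{\delta}{\dashrightarrow}$ an $\mathbb E$-triangle; it is split if $\delta=0$. Condition (WIC): if $gf$ is an inflation then so is $f$; if $gf$ is a deflation then so is $g$. Proper class. A class $\xi$ of $\mathbb E$-triangles closed under isomorphisms is proper if: (1) it is closed under finite coproducts and contains all split $\mathbb E$-triangles; (2) it is closed under base change (triangles realizing $c^*\delta$) and cobase change (triangles realizing $a_*\delta$); (3) it is saturated: given $\mathbb E$-triangles $A_i\to B_i\xrightarrow{y_i}C\overset{\delta_i}{\dashrightarrow}$ ($i=1,2$), if the second one and the $\mathbb E$-triangle $A_1\to M\to B_2\overset{y_2^*\delta_1}{\dashrightarrow}$ are in $\xi$, then the first one is in $\xi$.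 $P$ is $\xi$-projective if for each $\mathbb E$-triangle $A\to B\to C\dashrightarrow$ in $\xi$ the sequence $0\to\mathcal C(P,A)\to\mathcal C(P,B)\to\mathcal C(P,C)\to0$ is exact; $\mathcal P(\xi)$ is the class of $\xi$-projectives; $\xi$-injective is dual. Enough $\xi$-projectives: for each $A$ there is $K\to P\to A\dashrightarrow$ in $\xi$ with $P\in\mathcal P(\xi)$; enough $\xi$-injectives is dual. $Q$ is quasi-$\xi$-projective ($Q\in\mathcal{QP}(\xi)$) if for each $\mathbb E$-triangle $A\to Q\to B\dashrightarrow$ in $\xi$ the sequence $0\to\mathcal C(Q,A)\to\mathcal C(Q,Q)\to\mathcal C(Q,B)\to0$ is exact. An $\mathbb E$-triangle $A\to B\to C\dashrightarrow$ is $\mathcal C(-,\mathcal{QP}(\xi))$-exact if $0\to\mathcal C(C,Q)\to\mathcal C(B,Q)\to\mathcal C(A,Q)\to0$ is exact for all $Q\in\mathcal{QP}(\xi)$. A complex $\cdots\to X_1\xrightarrow{d_1}X_0\xrightarrow{d_0}X_{-1}\to\cdots$ is $\xi$-exact if for each $n$ there is an $\mathbb E$-triangle $K_{n+1}\xrightarrow{g_n}X_n\xrightarrow{f_n}K_n\dashrightarrow$ in $\xi$ with $d_n=g_{n-1}f_n$ (its $\xi$-resolution $\mathbb E$-triangles); it is $\mathcal C(-,\mathcal{QP}(\xi))$-exact if moreover these $\mathbb E$-triangles are $\mathcal C(-,\mathcal{QP}(\xi))$-exact. An object is quasi-$\xi$-Gorenstein projective (in $\mathcal{QGP}(\xi)$)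 if it is one of the objects $K_n$ for some $\mathcal C(-,\mathcal{QP}(\xi))$-exact complex all of whose terms are $\xi$-projective. *)

(* Defs.v *)
From HB Require Import structures.
From mathcomp Require Import all_boot all_order all_algebra.

Set Implicit Arguments.
Unset Strict Implicit.
Unset Printing Implicit Defensive.

Import GRing.Theory.
Local Open Scope ring_scope.

Declare Scope cat_scope.
Delimit Scope cat_scope with cat.
Local Open Scope cat_scope.

Reserved Notation "g ∘ f" (at level 40, left associativity).

(* A zero object and binary biproducts are part of the data; equality of
   morphisms is Leibniz equality in the abelian groups [hom A B]. *)
Record additiveCategory := AdditiveCategory {
  obj :> Type;
  hom : obj -> obj -> zmodType;
  idm : forall A, hom A A;
  cmp : forall A B C, hom B C -> hom A B -> hom A C;
  cmpA : forall A B C D (h : hom C D) (g : hom B C) (f : hom A B),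
    cmp h (cmp g f) = cmp (cmp h g) f;
  cmp1m : forall A B (f : hom A B), cmp (idm B) f = f;
  cmpm1 : forall A B (f : hom A B), cmp f (idm A) = f;
  cmpDl : forall A B C (g g' : hom B C) (f : hom A B),
    cmp (g + g') f = cmp g f + cmp g' f;
  cmpDr : forall A B C (g : hom B C) (f f' : hom A B),
    cmp g (f + f') = cmp g f + cmp g f';
  zero_obj : obj;
  idm_zero_obj : idm zero_obj = 0;
  dsum : obj -> obj -> obj;
  in1 : forall A B, hom A (dsum A B);
  in2 : forall A B, hom B (dsum A B);
  pr1 : forall A B, hom (dsum A B) A;
  pr2 : forall A B, hom (dsum A B) B;
  pr1_in1 : forall A B, cmp (pr1 A B) (in1 A B) = idm A;
  pr2_in2 : forall A B, cmp (pr2 A B) (in2 A B) = idm B;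
  pr1_in2 : forall A B, cmp (pr1 A B) (in2 A B) = 0;
  pr2_in1 : forall A B, cmp (pr2 A B) (in1 A B) = 0;
  in_pr : forall A B,
    cmp (in1 A B) (pr1 A B) + cmp (in2 A B) (pr2 A B) = idm (dsum A B)
}.

Arguments hom {_} _ _.
Arguments idm {_} _.
Arguments cmp {_ _ _ _} _ _.
Arguments dsum {_} _ _.
Arguments in1 {_} _ _.
Arguments in2 {_} _ _.
Arguments pr1 {_} _ _.
Arguments pr2 {_} _ _.

Notation "g ∘ f" := (cmp g f) : cat_scope.

Definition is_iso (C : additiveCategory) (A B : C) (f : hom A B) : Prop :=
  exists g : hom B A, g ∘ f = idm A /\ f ∘ g = idm B.

Definition isomorphic (C : additiveCategory) (A B : C) : Prop :=
  exists f : hom A B, is_iso f.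

Definition direct_summand (C : additiveCategory) (A M : C) : Prop :=
  exists B : C, isomorphic M (dsum A B).

Definition dsum_hom (C : additiveCategory) (A A' B B' : C)
    (f : hom A B) (f' : hom A' B') : hom (dsum A A') (dsum B B') :=
  in1 B B' ∘ f ∘ pr1 A A' + in2 B B' ∘ f' ∘ pr2 A A'.

(* [ext C A] is E(C,A): contravariant in the first argument, covariant in the
   second; [push a d] is a_* d and [pull c d] is c^* d. *)
Record biadditiveFunctor (K : additiveCategory) := BiadditiveFunctor {
  ext :> K -> K -> zmodType;
  push : forall C A A' : K, hom A A' -> ext C A -> ext C A';
  pull : forall A C C' : K, hom C' C -> ext C A -> ext C' A;
  push1 : forall C A (d : ext C A), push (idm A) d = d;
  pull1 : forall A C (d : ext C A), pull (idm C) d = d;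
  push_comp : forall C A A' A'' (a' : hom A' A'') (a : hom A A') (d : ext C A),
    push (a' ∘ a) d = push a' (push a d);
  pull_comp : forall A C C' C'' (c : hom C' C) (c' : hom C'' C') (d : ext C A),
    pull (c ∘ c') d = pull c' (pull c d);
  push_pull : forall A A' C C' (a : hom A A') (c : hom C' C) (d : ext C A),
    push a (pull c d) = pull c (push a d);
  pushDr : forall C A A' (a : hom A A') (d d' : ext C A),
    push a (d + d') = push a d + push a d';
  pullDr : forall A C C' (c : hom C' C) (d d' : ext C A),
    pull c (d + d') = pull c d + pull c d';
  pushDl : forall C A A' (a a' : hom A A') (d : ext C A),
    push (a + a') d = push a d + push a' d;
  pullDl : forall A C C' (c c' : hom C' C) (d : ext C A),
    pull (c + c') d = pull c d + pull c' d
}.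

Arguments push {K b C A A'} _ _.
Arguments pull {K b A C C'} _ _.

(* The element of E(C (+) C', A (+) A') with components (d, 0, 0, d'). *)
Definition dsum_ext (K : additiveCategory) (E : biadditiveFunctor K)
    (A A' C C' : K) (d : E C A) (d' : E C' A') : E (dsum C C') (dsum A A') :=
  push (in1 A A') (pull (pr1 C C') d) + push (in2 A A') (pull (pr2 C C') d').

Record sequence (K : additiveCategory) (A C : K) := Sequence {
  mid : K;
  seq_fst : hom A mid;
  seq_snd : hom mid C
}.

Definition seq_equiv (K : additiveCategory) (A C : K) (t u : sequence A C) :=
  exists b : hom (mid t) (mid u),
    [/\ is_iso b, b ∘ seq_fst t = seq_fst u & seq_snd u ∘ b = seq_snd t].

(* An assignment of a collection of sequences to each extension; [realization]
   below requires these collections to be equivalence classes. *)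
Definition correspondence (K : additiveCategory) (E : biadditiveFunctor K) :=
  forall A C : K, E C A -> sequence A C -> Prop.

Section Extriangulated.

Variables (K : additiveCategory) (E : biadditiveFunctor K).
Variable s : correspondence E.

Definition realizes (A B C : K) (x : hom A B) (y : hom B C) (d : E C A) : Prop :=
  s d (Sequence x y).

Definition ext_morphism (A A' C C' : K) (d : E C A) (d' : E C' A')
    (a : hom A A') (c : hom C C') : Prop :=
  push a d = pull c d'.

Record realization : Prop := Realization {
  real_class : forall (A C : K) (d : E C A),
    exists t : sequence A C, forall u, s d u <-> seq_equiv t u;
  real_morphism : forall (A B C A' B' C' : K)
      (x : hom A B) (y : hom B C) (d : E C A)
      (x' : hom A' B') (y' : hom B' C') (d' : E C' A')
      (a : hom A A') (c : hom C C'),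
    realizes x y d -> realizes x' y' d' -> ext_morphism d d' a c ->
    exists b : hom B B', b ∘ x = x' ∘ a /\ y' ∘ b = c ∘ y
}.

Record additive_realization : Prop := AdditiveRealization {
  areal_real : realization;
  areal_zero : forall A C : K, realizes (in1 A C) (pr2 A C) 0;
  areal_dsum : forall (A B C A' B' C' : K)
      (x : hom A B) (y : hom B C) (d : E C A)
      (x' : hom A' B') (y' : hom B' C') (d' : E C' A'),
    realizes x y d -> realizes x' y' d' ->
    realizes (dsum_hom x x') (dsum_hom y y') (dsum_ext d d')
}.

Definition ET3 : Prop :=
  forall (A B C A' B' C' : K)
    (x : hom A B) (y : hom B C) (d : E C A)
    (x' : hom A' B') (y' : hom B' C') (d' : E C' A')
    (a : hom A A') (b : hom B B'),
  realizes x y d -> realizes x' y' d' -> b ∘ x = x' ∘ a ->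
  exists c : hom C C', c ∘ y = y' ∘ b /\ ext_morphism d d' a c.

Definition ET3op : Prop :=
  forall (A B C A' B' C' : K)
    (x : hom A B) (y : hom B C) (d : E C A)
    (x' : hom A' B') (y' : hom B' C') (d' : E C' A')
    (b : hom B B') (c : hom C C'),
  realizes x y d -> realizes x' y' d' -> c ∘ y = y' ∘ b ->
  exists a : hom A A', b ∘ x = x' ∘ a /\ ext_morphism d d' a c.

Definition ET4 : Prop :=
  forall (A B C D F : K)
    (f : hom A B) (f' : hom B D) (d1 : E D A)
    (g : hom B C) (g' : hom C F) (d2 : E F B),
  realizes f f' d1 -> realizes g g' d2 ->
  exists (X : K) (h' : hom C X) (d : hom D X) (e : hom X F) (d3 : E X A),
    [/\ h' ∘ g = d ∘ f' /\ e ∘ h' = g',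
        realizes (g ∘ f) h' d3,
        realizes d e (push f' d2),
        pull d d3 = d1 &
        push f d3 = pull e d2].

Definition ET4op : Prop :=
  forall (A B C D F : K)
    (f' : hom D B) (f : hom B A) (d1 : E A D)
    (g' : hom F C) (g : hom C B) (d2 : E B F),
  realizes f' f d1 -> realizes g' g d2 ->
  exists (X : K) (h' : hom X C) (d : hom X D) (e : hom F X) (d3 : E A X),
    [/\ g ∘ h' = f' ∘ d /\ h' ∘ e = g',
        realizes h' (f ∘ g) d3,
        realizes e d (pull f' d2),
        push d d3 = d1 &
        pull f d3 = push e d2].

(* (ET1) is part of [biadditiveFunctor]. *)
Record extriangulated : Prop := Extriangulated {
  et2 : additive_realization;
  et3 : ET3;
  et3op : ET3op;
  et4 : ET4;
  et4op : ET4op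
}.

Definition inflation (A B : K) (x : hom A B) : Prop :=
  exists (C : K) (y : hom B C) (d : E C A), realizes x y d.

Definition deflation (B C : K) (y : hom B C) : Prop :=
  exists (A : K) (x : hom A B) (d : E C A), realizes x y d.

Definition WIC : Prop :=
  (forall (A B C : K) (f : hom A B) (g : hom B C),
     inflation (g ∘ f) -> inflation f) /\
  (forall (A B C : K) (f : hom A B) (g : hom B C),
     deflation (g ∘ f) -> deflation g).

(* A class of E-triangles is a predicate on triples (x, y, d) all of whose
   members satisfy [realizes x y d]; see [proper_real]. *)
Definition triangle_class :=
  forall A B C : K, hom A B -> hom B C -> E C A -> Prop.

(* Closure under finite coproducts amounts to closure under binary ones: the
   empty coproduct is a split E-triangle. *)
Record proper_class (xi : triangle_class) : Prop := ProperClass {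
  proper_real : forall (A B C : K) (x : hom A B) (y : hom B C) (d : E C A),
    xi _ _ _ x y d -> realizes x y d;
  proper_iso : forall (A B C A' B' C' : K)
      (x : hom A B) (y : hom B C) (d : E C A)
      (x' : hom A' B') (y' : hom B' C') (d' : E C' A')
      (a : hom A A') (b : hom B B') (c : hom C C'),
    is_iso a -> is_iso b -> is_iso c ->
    b ∘ x = x' ∘ a -> c ∘ y = y' ∘ b -> ext_morphism d d' a c ->
    xi _ _ _ x y d -> realizes x' y' d' -> xi _ _ _ x' y' d';
  proper_dsum : forall (A B C A' B' C' : K)
      (x : hom A B) (y : hom B C) (d : E C A)
      (x' : hom A' B') (y' : hom B' C') (d' : E C' A'),
    xi _ _ _ x y d -> xi _ _ _ x' y' d' ->
    xi _ _ _ (dsum_hom x x') (dsum_hom y y') (dsum_ext d d');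
  proper_split : forall (A B C : K) (x : hom A B) (y : hom B C),
    realizes x y 0 -> xi _ _ _ x y 0;
  proper_base : forall (A B C B' C' : K)
      (x : hom A B) (y : hom B C) (d : E C A)
      (c : hom C' C) (x' : hom A B') (y' : hom B' C'),
    xi _ _ _ x y d -> realizes x' y' (pull c d) -> xi _ _ _ x' y' (pull c d);
  proper_cobase : forall (A B C A' B' : K)
      (x : hom A B) (y : hom B C) (d : E C A)
      (a : hom A A') (x' : hom A' B') (y' : hom B' C),
    xi _ _ _ x y d -> realizes x' y' (push a d) -> xi _ _ _ x' y' (push a d);
  proper_saturated : forall (A1 B1 A2 B2 C M : K)
      (x1 : hom A1 B1) (y1 : hom B1 C) (d1 : E C A1)
      (x2 : hom A2 B2) (y2 : hom B2 C) (d2 : E C A2)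
      (m : hom A1 M) (m' : hom M B2),
    realizes x1 y1 d1 -> xi _ _ _ x2 y2 d2 ->
    xi _ _ _ m m' (pull y2 d1) -> xi _ _ _ x1 y1 d1
}.

(* Exactness of 0 -> U -> V -> W -> 0 for the given maps of abelian groups. *)
Definition short_exact (U V W : zmodType) (f : U -> V) (g : V -> W) : Prop :=
  [/\ injective f,
      forall v, g v = 0 <-> exists u, f u = v &
      forall w, exists v, g v = w].

Definition covariant_exact (P A B C : K) (x : hom A B) (y : hom B C) : Prop :=
  short_exact (fun f : hom P A => x ∘ f) (fun f : hom P B => y ∘ f).

Definition contravariant_exact (Q A B C : K) (x : hom A B) (y : hom B C) : Prop :=
  short_exact (fun f : hom C Q => f ∘ y) (fun f : hom B Q => f ∘ x).

Variable xi : triangle_class.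

Definition xi_projective (P : K) : Prop :=
  forall (A B C : K) (x : hom A B) (y : hom B C) (d : E C A),
    xi x y d -> covariant_exact P x y.

Definition xi_injective (I : K) : Prop :=
  forall (A B C : K) (x : hom A B) (y : hom B C) (d : E C A),
    xi x y d -> contravariant_exact I x y.

Definition enough_projectives : Prop :=
  forall A : K, exists (N P : K) (x : hom N P) (y : hom P A) (d : E A N),
    xi_projective P /\ xi x y d.

Definition enough_injectives : Prop :=
  forall A : K, exists (I N : K) (x : hom A I) (y : hom I N) (d : E N A),
    xi_injective I /\ xi x y d.

Definition quasi_projective (Q : K) : Prop :=
  forall (A B : K) (x : hom A Q) (y : hom Q B) (d : E B A),
    xi x y d -> covariant_exact Q x y.

Definition QP_exact (A B C : K) (x : hom A B) (y : hom B C) : Prop :=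
  forall Q : K, quasi_projective Q -> contravariant_exact Q x y.

(* [cdiff X n] is the differential X_{n+1} -> X_n usually written d_{n+1}, so
   that no transport along (n - 1) + 1 = n is needed. *)
Record complex := Complex {
  cobj : int -> K;
  cdiff : forall n : int, hom (cobj (n + 1)) (cobj n);
  cdiffK : forall n : int, cdiff n ∘ cdiff (n + 1) = 0
}.

(* The E-triangles K_{n+1} -g_n-> X_n -f_n-> K_n --> of a xi-exact complex. *)
Record resolution_triangles (X : complex) := ResolutionTriangles {
  syz : int -> K;
  syz_in : forall n : int, hom (syz (n + 1)) (cobj X n);
  syz_out : forall n : int, hom (cobj X n) (syz n);
  syz_ext : forall n : int, E (syz n) (syz (n + 1));
  syz_xi : forall n : int, xi (syz_in n) (syz_out n) (syz_ext n);
  syz_diff : forall n : int, cdiff X n = syz_in n ∘ syz_out (n + 1)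
}.

Definition QGP (G : K) : Prop :=
  exists (X : complex) (T : resolution_triangles X),
    [/\ forall n : int, xi_projective (cobj X n),
        forall n : int, QP_exact (syz_in T n) (syz_out T n) &
        exists n : int, G = syz T n].

End Extriangulated.

(* Main.v *)
(* Let R be the class of retracts of objects M (+) P with M in QGP(xi) and P
   xi-projective. For every G in R, all xi-triangles ending in G are
   C(-, QP(xi))-exact: pull them back to M and to P.
   If M' -> P0 -> M lies in a complex defining M and G' -> Q -> G is in xi with
   Q projective, lifting G -> M and M -> G gives maps G' -> M' -> G' whose
   composite acts as the identity on the extension class, hence differs from 1
   by a map factoring through Q; so G' is a retract of M' (+) Q. Dually, for
   M -> P0 -> M', the composite G -> M (+) P -> P0 (+) P is an inflation whose
   extension class is obtained from that of M by base and cobase change, and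
   its cone is a retract of M' (+) (P0 (+) P). So R is stable in both
   directions, and iterating yields complete resolutions. *)

From mathcomp Require Import all_boot all_order all_algebra.
From Stdlib Require Import IndefiniteDescription.
Require Import Defs.

Set Implicit Arguments.
Unset Strict Implicit.
Unset Printing Implicit Defensive.

Import GRing.Theory.
Local Open Scope ring_scope.
Local Open Scope cat_scope.

(** * Zero and difference morphisms *)

Section AdditiveCategory.
Variable K : additiveCategory.

Lemma cmp0m (A B C : K) (f : hom A B) : (0 : hom B C) ∘ f = 0.
Proof. by apply: (addrI (0 ∘ f)); rewrite -cmpDl !addr0. Qed.

Lemma cmpm0 (A B C : K) (g : hom B C) : g ∘ (0 : hom A B) = 0.
Proof. by apply: (addrI (g ∘ 0)); rewrite -cmpDr !addr0. Qed.

Lemma cmpBl (A B C : K) (g g' : hom B C) (f : hom A B) :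
  (g - g') ∘ f = g ∘ f - g' ∘ f.
Proof. by apply: (addIr (g' ∘ f)); rewrite -cmpDl !subrK. Qed.

Lemma hom_zero_obj (A : K) (f : hom (zero_obj K) A) : f = 0.
Proof. by rewrite -(cmpm1 f) idm_zero_obj cmpm0. Qed.

End AdditiveCategory.

(** * Zero and differences in the bifunctor E *)

Section BiadditiveFunctor.
Variables (K : additiveCategory) (E : biadditiveFunctor K).

Lemma push0r (C A A' : K) (a : hom A A') : push a (0 : E C A) = 0.
Proof. by apply: (addrI (push a 0)); rewrite -pushDr !addr0. Qed.

Lemma pull0r (A C C' : K) (c : hom C' C) : pull c (0 : E C A) = 0.
Proof. by apply: (addrI (pull c 0)); rewrite -pullDr !addr0. Qed.

Lemma pushBl (C A A' : K) (a a' : hom A A') (d : E C A) :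
  push (a - a') d = push a d - push a' d.
Proof. by apply: (addIr (push a' d)); rewrite -pushDl !subrK. Qed.

Lemma pullBl (A C C' : K) (c c' : hom C' C) (d : E C A) :
  pull (c - c') d = pull c d - pull c' d.
Proof. by apply: (addIr (pull c' d)); rewrite -pullDl !subrK. Qed.

End BiadditiveFunctor.

(** * Inflations built from compositions and split triangles *)

Section Triangles.
Variables (K : additiveCategory) (E : biadditiveFunctor K).
Variables (s : correspondence E) (hs : extriangulated s).

Let hreal : realization s := areal_real (et2 hs).
Let split_real (A C : K) : realizes s (in1 A C) (pr2 A C) 0 :=
  areal_zero (et2 hs) A C.

Lemma realizes_ex (A C : K) (d : E C A) :
  exists (B : K) (x : hom A B) (y : hom B C), realizes s x y d.
Proof.
have [[B x y] ht] := real_class hreal d.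
exists B, x, y; apply/ht; exists (idm B); split; rewrite ?cmpm1 ?cmp1m //.
by exists (idm B); rewrite cmpm1.
Qed.

Lemma inflation_comp (A B C : K) (f : hom A B) (g : hom B C) :
  inflation s f -> inflation s g -> inflation s (g ∘ f).
Proof.
move=> [D [f' [d1 h1]]] [F [g' [d2 h2]]].
have [X [h' [_ [_ [d3 [_ h3 _ _ _]]]]]] := et4 hs h1 h2.
by exists X, h', d3.
Qed.

(** Following [i] by [in1 A 0 ∘ p] gives the inflation of the split triangle A -> A (+) 0 -> 0, and
    (WIC) strips the second factor. *)
Lemma inflation_section (hwic : WIC s) (A B : K) (i : hom A B) (p : hom B A) :
  p ∘ i = idm A -> inflation s i.
Proof.
move=> pi; apply: (hwic.1 _ _ _ i (in1 A (zero_obj K) ∘ p)).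
rewrite -cmpA pi cmpm1.
by exists (zero_obj K), (pr2 _ _), 0.
Qed.

(** The column (i, j) is split mono, hence an inflation; composed with x (+) [in1 P' 0] it factors
    through the column (x i, j), to which (WIC) applies. *)
Lemma inflation_row (hwic : WIC s) (A M P P' : K) (x : hom M P)
    (i : hom A M) (p : hom M A) (j : hom A P') (q : hom P' A) :
  inflation s x -> p ∘ i + q ∘ j = idm A ->
  inflation s (in1 P P' ∘ (x ∘ i) + in2 P P' ∘ j).
Proof.
move=> [N [y [d hx]]] pq.
set k := in1 M P' ∘ i + in2 M P' ∘ j.
have kinfl : inflation s k.
  apply: (@inflation_section hwic _ _ k (p ∘ pr1 M P' + q ∘ pr2 M P')).
  rewrite /k !cmpDl !cmpDr -!cmpA !(cmpA (pr1 _ _)) !(cmpA (pr2 _ _)).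
  rewrite pr1_in1 pr1_in2 pr2_in1 pr2_in2.
  by rewrite !cmp1m !cmp0m !cmpm0 addr0 add0r.
pose O := zero_obj K.
have hsum := areal_dsum (et2 hs) hx (split_real P' O).
have xinfl : inflation s (dsum_hom x (in1 P' O)).
  by exists _, (dsum_hom y (pr2 P' O)), (dsum_ext d 0).
have := inflation_comp kinfl xinfl.
suff -> : dsum_hom x (in1 P' O) ∘ k =
    dsum_hom (idm P) (in1 P' O) ∘ (in1 P P' ∘ (x ∘ i) + in2 P P' ∘ j).
  exact: hwic.1.
rewrite /k /dsum_hom !cmpDl !cmpDr -!cmpA !(cmpA (pr1 _ _)) !(cmpA (pr2 _ _)).
rewrite !pr1_in1 !pr1_in2 !pr2_in1 !pr2_in2.
by rewrite !cmp1m !cmp0m !cmpm0.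
Qed.

(** * Exactness around a single E-triangle, by comparison with split ones *)

Section OneTriangle.
Variables (A B C : K) (x : hom A B) (y : hom B C) (d : E C A).
Hypothesis hxy : realizes s x y d.

Lemma deflation_inflation0 : y ∘ x = 0.
Proof.
have [|c [cE _]] := et3 hs (a := idm A) (b := x ∘ pr1 A (zero_obj K))
  (split_real A (zero_obj K)) hxy.
  by rewrite -cmpA pr1_in1 !cmpm1.
have : (y ∘ (x ∘ pr1 A (zero_obj K))) ∘ in1 A _ = 0.
  by rewrite -cE (hom_zero_obj c) !cmp0m.
by rewrite -!cmpA pr1_in1 cmpm1.
Qed.

Lemma push_inflation0 : push x d = 0.
Proof.
have [c [_ cE]] := et3 hs hxy (split_real B (zero_obj K))
  (erefl (in1 B (zero_obj K) ∘ x)).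
by rewrite cE pull0r.
Qed.

Lemma pull_deflation0 : pull y d = 0.
Proof.
have [a [_ aE]] := et3op hs (split_real (zero_obj K) B) hxy
  (erefl (y ∘ pr2 (zero_obj K) B)).
by rewrite -aE push0r.
Qed.

Lemma factor_deflation (Z : K) (g : hom B Z) :
  g ∘ x = 0 -> exists h : hom C Z, g = h ∘ y.
Proof.
move=> gx0.
have [|h [hE _]] := et3 hs (a := 0) (b := in2 (zero_obj K) Z ∘ g)
  hxy (split_real (zero_obj K) Z).
  by rewrite -cmpA gx0 !cmpm0.
by exists h; rewrite hE cmpA pr2_in2 cmp1m.
Qed.

Lemma factor_inflation (Z : K) (f : hom A Z) :
  push f d = 0 -> exists h : hom B Z, f = h ∘ x.
Proof.
move=> fd0.
have [|b [bx _]] := real_morphism hreal (a := f) (c := idm C)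
  hxy (split_real Z C).
  by rewrite /ext_morphism fd0 pull0r.
by exists (pr1 Z C ∘ b); rewrite -cmpA bx cmpA pr1_in1 cmp1m.
Qed.

Lemma lift_deflation (Z : K) (c : hom Z C) :
  pull c d = 0 -> exists h : hom Z B, c = y ∘ h.
Proof.
move=> cd0.
have [|b [_ yb]] := real_morphism hreal (a := idm A) (c := c)
  (split_real A Z) hxy.
  by rewrite /ext_morphism cd0 push0r.
by exists (b ∘ in2 A Z); rewrite cmpA yb -cmpA pr2_in2 cmpm1.
Qed.

(** Exactness in the middle is automatic; surjectivity on the right is the vanishing of the
    connecting map [push f d]. *)
Lemma contravariant_exactP (Z : K) :
  (forall f : hom C Z, f ∘ y = 0 -> f = 0) ->
  (forall f : hom A Z, push f d = 0) -> contravariant_exact Z x y.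
Proof.
move=> inj ext0; split.
- move=> f g /= fg; apply/eqP; rewrite -subr_eq0; apply/eqP; apply: inj.
  by rewrite cmpBl fg subrr.
- move=> v; split=> [/factor_deflation [h ->]|[h <-]]; first by exists h.
  by rewrite -cmpA deflation_inflation0 cmpm0.
- by move=> f; have [h ->] := factor_inflation (ext0 f); exists h.
Qed.

Lemma contravariant_exact_inj (Z : K) (f : hom C Z) :
  contravariant_exact Z x y -> f ∘ y = 0 -> f = 0.
Proof. by case=> inj _ _ fy0; apply: inj; rewrite fy0 cmp0m. Qed.

Lemma contravariant_exact_push0 (Z : K) (f : hom A Z) :
  contravariant_exact Z x y -> push f d = 0.
Proof.
by case=> _ _ /(_ f) [h <-]; rewrite push_comp push_inflation0 push0r.
Qed.

End OneTriangle.

(** * Projectives and exactness relative to a proper class *)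

Section ProperClass.
Variables (xi : triangle_class E) (hxi : proper_class s xi).

Lemma xi_projective_quasi (P : K) : xi_projective xi P -> quasi_projective xi P.
Proof. by move=> hP A B x y d /hP. Qed.

Lemma xi_projective_dsum (P P' : K) :
  xi_projective xi P -> xi_projective xi P' -> xi_projective xi (dsum P P').
Proof.
move=> hP hP' A B C x y d hx.
have [i1 e1 s1] := hP _ _ _ _ _ _ hx; have [i2 e2 s2] := hP' _ _ _ _ _ _ hx.
have dsumE (Z : K) (f : hom (dsum P P') Z) :
    f = f ∘ in1 P P' ∘ pr1 P P' + f ∘ in2 P P' ∘ pr2 P P'.
  by rewrite -!cmpA -cmpDr in_pr cmpm1.
split.
- move=> f g /= fg; rewrite (dsumE _ f) (dsumE _ g).
  rewrite (i1 (f ∘ in1 P P') (g ∘ in1 P P')) /= ?cmpA ?fg //.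
  by rewrite (i2 (f ∘ in2 P P') (g ∘ in2 P P')) /= ?cmpA ?fg.
- move=> v; split=> [yv0|[u <-]].
    have [|u1 u1E] := (e1 (v ∘ in1 P P')).1; first by rewrite cmpA yv0 cmp0m.
    have [|u2 u2E] := (e2 (v ∘ in2 P P')).1; first by rewrite cmpA yv0 cmp0m.
    exists (u1 ∘ pr1 P P' + u2 ∘ pr2 P P').
    by rewrite cmpDr !cmpA u1E u2E -dsumE.
  by rewrite cmpA (deflation_inflation0 (proper_real hxi hx)) cmp0m.
- move=> w; have [v1 v1E] := s1 (w ∘ in1 P P').
  have [v2 v2E] := s2 (w ∘ in2 P P').
  exists (v1 ∘ pr1 P P' + v2 ∘ pr2 P P').
  by rewrite cmpDr !cmpA v1E v2E -dsumE.
Qed.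

Lemma xi_pullback (A B C C' : K) (x : hom A B) (y : hom B C) (d : E C A)
    (c : hom C' C) :
  xi x y d -> exists (B' : K) (x' : hom A B') (y' : hom B' C') (b : hom B' B),
    xi x' y' (pull c d) /\ y ∘ b = c ∘ y'.
Proof.
move=> hx; have [B' [x' [y' hx']]] := realizes_ex (pull c d).
have [|b [_ yb]] := real_morphism hreal (a := idm A) (c := c)
  hx' (proper_real hxi hx).
  by rewrite /ext_morphism push1.
exists B', x', y', b; split=> //; exact: (proper_base hxi hx hx').
Qed.

(** Quantifying over all [xi]-triangles ending in [C], not a chosen one, lets the property pass to
    retracts. *)
Definition QP_exact_target (C : K) : Prop :=
  forall (A B : K) (x : hom A B) (y : hom B C) (d : E C A),
    xi x y d -> QP_exact xi x y.

Lemma xi_projective_pull0 (P A B C : K) (x : hom A B) (y : hom B C) (d : E C A)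
    (c : hom P C) :
  xi_projective xi P -> xi x y d -> pull c d = 0.
Proof.
move=> hP hx; have [_ _ /(_ c) [h <-]] := hP _ _ _ _ _ _ hx.
by rewrite pull_comp (pull_deflation0 (proper_real hxi hx)) pull0r.
Qed.

Lemma xi_projective_QP_exact_target (P : K) :
  xi_projective xi P -> QP_exact_target P.
Proof.
move=> hP A B x y d hx Q hQ.
apply: (contravariant_exactP (proper_real hxi hx)) => f.
- have [_ _ /(_ (idm P)) [h hE]] := hP _ _ _ _ _ _ hx.
  by move=> fy0; rewrite -(cmpm1 f) -hE cmpA fy0 cmp0m.
- by rewrite -(pull1 d) (xi_projective_pull0 _ hP hx) push0r.
Qed.

(** Lifting [y0] through [y] exhibits [d] as a pushforward of [d0], so both conditions of
    [contravariant_exactP] transfer from [d0] to [d]. *)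
Lemma QP_exact_target_of_triangle (N P C : K)
    (x0 : hom N P) (y0 : hom P C) (d0 : E C N) :
  xi_projective xi P -> xi x0 y0 d0 -> QP_exact xi x0 y0 -> QP_exact_target C.
Proof.
move=> hP hx0 hQP A B x y d hx Q hQ.
have [_ _ /(_ y0) [t tE]] := hP _ _ _ _ _ _ hx.
have r0 := proper_real hxi hx0; have r := proper_real hxi hx.
apply: (contravariant_exactP r) => f.
- move=> fy0; apply: (contravariant_exact_inj (hQP Q hQ)).
  by rewrite -tE cmpA fy0 cmp0m.
- have [|a [_ aE]] := et3op hs (b := t) (c := idm C) r0 r.
    by rewrite cmp1m tE.
  move: aE; rewrite /ext_morphism pull1 => <-.
  by rewrite -push_comp (contravariant_exact_push0 r0 _ (hQP Q hQ)).
Qed.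

Lemma QP_exact_target_retract (M P G : K) (i : hom G M) (p : hom M G)
    (j : hom G P) (q : hom P G) :
  QP_exact_target M -> QP_exact_target P -> p ∘ i + q ∘ j = idm G ->
  QP_exact_target G.
Proof.
move=> hM hP pq A B x y d hx Q hQ.
(* What exactness of the pullback along [r] says about the original triangle; used for [p] and
   [q]. *)
have restr (N : K) (r : hom N G) : QP_exact_target N ->
    (forall f : hom G Q, f ∘ y = 0 -> f ∘ r = 0) /\
    (forall f : hom A Q, push f (pull r d) = 0).
  move=> hN; have [B' [x' [y' [b [hx' yb]]]]] := xi_pullback r hx.
  have ex := hN _ _ _ _ _ hx' Q hQ; split=> f.
    move=> fy0; apply: (contravariant_exact_inj ex).
    by rewrite -cmpA -yb cmpA fy0 cmp0m.
  exact: (contravariant_exact_push0 (proper_real hxi hx') _ ex).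
have [injM pushM] := restr M p hM; have [injP pushP] := restr P q hP.
apply: (contravariant_exactP (proper_real hxi hx)) => f.
- move=> fy0; rewrite -(cmpm1 f) -pq cmpDr !cmpA injM // injP //.
  by rewrite !cmp0m addr0.
- rewrite -(pull1 d) -pq pullDl !pull_comp pushDr.
  by rewrite (push_pull f i) (push_pull f j) pushM pushP !pull0r addr0.
Qed.

(** * Splicing triangles into complete resolutions *)

Definition QP_step (A C : K) : Prop :=
  exists (P : K) (x : hom A P) (y : hom P C) (d : E C A),
    [/\ xi_projective xi P, xi x y d & QP_exact xi x y].

Lemma QGP_left (G : K) : QGP xi G -> exists2 G', QGP xi G' & QP_step G' G.
Proof.
move=> [X [T [hP hQP [n ->]]]]; exists (syz T (n + 1)).
  by exists X, T; split=> //; exists (n + 1).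
exists (cobj X n), (syz_in T n), (syz_out T n), (syz_ext T n).
by split=> //; apply: syz_xi.
Qed.

Lemma QGP_right (G : K) : QGP xi G -> exists2 G', QGP xi G' & QP_step G G'.
Proof.
move=> [X [T [hP hQP [n ->]]]]; exists (syz T (n - 1)).
  by exists X, T; split=> //; exists (n - 1).
(* The source of [syz_in T (n - 1)] has index n - 1 + 1, not n. *)
rewrite -{1}(subrK 1 n).
exists (cobj X (n - 1)), (syz_in T _), (syz_out T _), (syz_ext T _).
by split=> //; apply: syz_xi.
Qed.

Lemma QP_exact_target_QGP (G : K) : QGP xi G -> QP_exact_target G.
Proof.
move=> /QGP_left [G' _ [P [x [y [d [hP hx hQP]]]]]].
exact: QP_exact_target_of_triangle hP hx hQP.
Qed.

(** A complex is data, so the objects and morphisms of each step are chosen one existential at a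
    time, then spliced. *)
Lemma QGP_of_steps (Z : int -> K) :
  (forall n, QP_step (Z (n + 1)) (Z n)) -> forall n, QGP xi (Z n).
Proof.
move=> hZ.
pose step n := constructive_indefinite_description _ (hZ n).
pose P n := sval (step n).
pose step1 n := constructive_indefinite_description _ (svalP (step n)).
pose x n : hom (Z (n + 1)) (P n) := sval (step1 n).
pose step2 n := constructive_indefinite_description _ (svalP (step1 n)).
pose y n : hom (P n) (Z n) := sval (step2 n).
pose step3 n := constructive_indefinite_description _ (svalP (step2 n)).
pose d n : E (Z n) (Z (n + 1)) := sval (step3 n).
have hstep n : [/\ xi_projective xi (P n), xi (x n) (y n) (d n)
    & QP_exact xi (x n) (y n)] := svalP (step3 n).
have hx n : xi (x n) (y n) (d n) by have [] := hstep n.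
have diffK n : (x n ∘ y (n + 1)) ∘ (x (n + 1) ∘ y (n + 1 + 1)) = 0.
  rewrite cmpA -(cmpA (x n)).
  by rewrite (deflation_inflation0 (proper_real hxi (hx _))) cmpm0 cmp0m.
pose X := Complex diffK.
pose T := @ResolutionTriangles _ _ xi X Z x y d hx (fun n => erefl).
move=> n; exists X, T; split=> [m|m|]; last by exists n.
  by have [] := hstep m.
by have [] := hstep m.
Qed.

(** A coinduction principle: choose successors inside [R] in both directions, starting from [G] at
    index 0. *)
Lemma QGP_coind (R : K -> Prop) :
  (forall G, R G -> exists2 G', R G' & QP_step G' G) ->
  (forall G, R G -> exists2 G', R G' & QP_step G G') ->
  forall G, R G -> QGP xi G.
Proof.
move=> hl hr G hG.
have hl' (u : sig R) : exists v : sig R, QP_step (sval v) (sval u).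
  by have [H' hH' st] := hl _ (svalP u); exists (exist _ H' hH').
have hr' (u : sig R) : exists v : sig R, QP_step (sval u) (sval v).
  by have [H' hH' st] := hr _ (svalP u); exists (exist _ H' hH').
pose l u := sval (constructive_indefinite_description _ (hl' u)).
pose r u := sval (constructive_indefinite_description _ (hr' u)).
pose u0 : sig R := exist _ G hG.
(* [Negz k] is -(k + 1), so it takes k + 1 cosyzygies. *)
pose Z (n : int) := sval match n with
  | Posz k => iter k l u0 | Negz k => iter k.+1 r u0 end.
have hZ n : QP_step (Z (n + 1)) (Z n).
  case: n => [k|[|k]].
  - rewrite -PoszD addn1.
    exact: svalP (constructive_indefinite_description _ (hl' (iter k l u0))).
  - exact: svalP (constructive_indefinite_description _ (hr' u0)).
  - have -> : Negz k.+1 + 1 = Negz k.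
      by rewrite !NegzE -[k.+2]addn1 PoszD opprD subrK.
    exact: svalP (constructive_indefinite_description _ (hr' (iter k.+1 r u0))).
exact: (QGP_of_steps hZ 0).
Qed.

(* The projective summand makes the class stable under syzygies and cosyzygies
   without comparing complements. *)
Definition stable_retract (G : K) : Prop :=
  exists (M P : K) (i : hom G M) (p : hom M G) (j : hom G P) (q : hom P G),
    [/\ QGP xi M, xi_projective xi P & p ∘ i + q ∘ j = idm G].

Lemma QP_exact_target_stable (G : K) : stable_retract G -> QP_exact_target G.
Proof.
move=> [M [P [i [p [j [q [hM hP pq]]]]]]].
exact: QP_exact_target_retract (QP_exact_target_QGP hM)
  (xi_projective_QP_exact_target hP) pq.
Qed.

Lemma stable_retract_left (hproj : enough_projectives xi) (G : K) :
  stable_retract G -> exists2 G', stable_retract G' & QP_step G' G.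
Proof.
move=> hG; have [N [Q [x [y [d [hQ hx]]]]]] := hproj G.
exists N; last first.
  by exists Q, x, y, d; split=> //; apply: (QP_exact_target_stable hG hx).
case: hG => [M [P [i [p [j [q [hM hP pq]]]]]]].
have [M' hM' [P0 [x0 [y0 [d0 [hP0 hx0 _]]]]]] := QGP_left hM.
have r := proper_real hxi hx; have r0 := proper_real hxi hx0.
have [_ _ /(_ (p ∘ y0)) [b bE]] := hP0 _ _ _ _ _ _ hx.
have [_ _ /(_ (i ∘ y)) [b' bE']] := hQ _ _ _ _ _ _ hx0.
have [a [_ aE]] := et3op hs r0 r (esym bE).
have [a' [_ aE']] := et3op hs r r0 (esym bE').
(* Pushing [d] along a a' is pulling it along p i = 1 - q j, and pulling along [q] gives 0 because
   [P] is projective. *)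
have aa' : push (idm N - a ∘ a') d = 0.
  rewrite pushBl push1 push_comp aE' push_pull aE -pull_comp.
  rewrite -(addrK (q ∘ j) (p ∘ i)) pq pullBl pull1 pull_comp.
  by rewrite (xi_projective_pull0 q hP hx) pull0r subr0 subrr.
(* Hence 1 - a a' factors through [Q], the new projective summand. *)
have [t tE] := factor_inflation r aa'.
exists M', Q, a', a, x, t; split=> //.
by rewrite -tE addrC subrK.
Qed.

Lemma stable_retract_right (hwic : WIC s) (G : K) :
  stable_retract G -> exists2 G', stable_retract G' & QP_step G G'.
Proof.
move=> [M [P [i [p [j [q [hM hP pq]]]]]]].
have [M' hM' [P0 [x0 [y0 [d0 [hP0 hx0 hQP0]]]]]] := QGP_right hM.
have r0 := proper_real hxi hx0.
have hPP := xi_projective_dsum hP0 hP.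
have x0infl : inflation s x0 by exists M', y0, d0.
have [C [y [d r]]] := inflation_row hwic x0infl pq.
move: r; set x := _ + _ => r.
have x1 : pr1 P0 P ∘ x = x0 ∘ i.
  by rewrite cmpDr !cmpA pr1_in1 pr1_in2 cmp1m cmp0m addr0.
have x2 : pr2 P0 P ∘ x = j.
  by rewrite cmpDr !cmpA pr2_in1 pr2_in2 cmp1m !cmp0m add0r.
have [c [_ cE]] := et3 hs r r0 x1.
(* The right side is [d] pushed along p i = 1 - q j; as [j] factors through [x], the q j term kills
   [d]. *)
have dE : d = push p (pull c d0).
  rewrite -cE -push_comp -(addrK (q ∘ j) (p ∘ i)) pq pushBl push1 -x2.
  by rewrite !push_comp (push_inflation0 r) !push0r subr0.
have hx : xi x y d.
  have [B' [x' [y' [_ [hc _]]]]] := xi_pullback c hx0.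
  by move: (r); rewrite {1 2}dE; apply: proper_cobase hc.
(* QP-exactness extends x p along [x0], since the projective P0 (+) P is quasi-projective. *)
have [_ _ /(_ (x ∘ p)) [b bE]] := hQP0 _ (xi_projective_quasi hPP).
have [c' [_ cE']] := et3 hs r0 r bE.
have cc' : pull (idm C - c' ∘ c) d = 0.
  by rewrite pullBl pull1 pull_comp -cE' -push_pull -dE subrr.
(* Hence 1 - c' c factors through P0 (+) P. *)
have [t tE] := lift_deflation r cc'.
have hC : stable_retract C.
  exists M', (dsum P0 P), c, c', t, y; split=> //.
  by rewrite -tE addrC subrK.
exists C => //; exists (dsum P0 P), x, y, d; split=> //.
exact: (QP_exact_target_stable hC hx).
Qed.

End ProperClass.

End Triangles.

Theorem theorem4p8 (K : additiveCategory) (E : biadditiveFunctor K)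
    (s : correspondence E) (hs : extriangulated s) (hwic : WIC s)
    (xi : triangle_class E) (hxi : proper_class s xi)
    (hproj : enough_projectives xi) (hinj : enough_injectives xi)
    (M G : K) (hM : QGP xi M) (hG : direct_summand G M) :
  QGP xi G.
Proof.
have [H [f [g [gf fg]]]] := hG.
apply: (QGP_coind hs hxi (stable_retract_left hs hxi hproj)
  (stable_retract_right hs hxi hwic)).
(* Any projective [P] will do: the maps to and from it are 0. *)
have [Q [P [_ [_ [_ [hP _]]]]]] := hproj G.
exists M, P, (g ∘ in1 G H), (pr1 G H ∘ f), 0, 0; split=> //.
by rewrite cmpm0 addr0 -cmpA (cmpA f) fg cmp1m pr1_in1.
Qed.
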